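(* Let $\mathcal{A}$ be a unital $C^*$-algebra, $\mathcal{H}$ a Hilbert $\mathcal{A}$-module, $K\in End_{\mathcal{A}}^{*}(\mathcal{H})$, and $\mathbb{J}\subseteq\mathbb{N}$ a finite or countable index set. Let $\{T_i\}_{i\in\mathbb{J}}$ be a $K$-operator frame for $End_{\mathcal{A}}^{*}(\mathcal{H})$ with bounds $A$ and $B$, let $\{R_i\}_{i\in\mathbb{J}}\subset End_{\mathcal{A}}^{*}(\mathcal{H})$, and let $\{\alpha_i\}_{i\in\mathbb{J}},\{\beta_i\}_{i\in\mathbb{J}}\subset\mathbb{R}$ be two positively confined sequences. If there exist constants $0\le\lambda,\mu<1$ such that for all $x\in\mathcal{H}$ $$\Big\|\sum_{i\in\mathbb{J}}\langle(\alpha_iT_i-\beta_iR_i)x,(\alpha_iT_i-\beta_iR_i)x\rangle\Big\|^{\frac12}\le\lambda\Big\|\sum_{i\in\mathbb{J}}\langle\alpha_iT_ix,\alpha_iT_ix\rangle\Big\|^{\frac12}+\mu\Big\|\sum_{i\in\mathbb{J}}\langle\beta_iR_ix,\beta_iR_ix\rangle\Big\|^{\frac12},$$ then $\{R_i\}_{i\in\mathbb{J}}$ is a $K$-operator frame for $End_{\mathcal{A}}^{*}(\mathcal{H})$.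
   Context: Hilbert $\mathcal{A}$-modules are left modules with $\mathcal{A}$-valued inner product $\langle\cdot,\cdot\rangle$, $\mathcal{A}$-linear in the first variable, with $\langle x,y\rangle=\langle y,x\rangle^*$, complete for $\|x\|=\|\langle x,x\rangle\|^{1/2}$. $End_{\mathcal{A}}^{*}(\mathcal{H})$ is the set of adjointable operators on $\mathcal{H}$. Inequalities between elements of $\mathcal{A}$ refer to the usual order given by the positive cone of $\mathcal{A}$. For $K\in End_{\mathcal{A}}^{*}(\mathcal{H})$, a family $\{T_i\}_{i\in\mathbb{J}}\subset End_{\mathcal{A}}^{*}(\mathcal{H})$ is a $K$-operator frame for $End_{\mathcal{A}}^{*}(\mathcal{H})$ with (lower and upper) bounds $A,B>0$ if $A\langle K^*x,K^*x\rangle\le\sum_{i\in\mathbb{J}}\langle T_ix,T_ix\rangle\le B\langle x,x\rangle$ for all $x\in\mathcal{H}$; it is a $K$-operator frame if such constants exist. A sequence $\{\alpha_i\}_{i\in\mathbb{J}}\subset\mathbb{R}$ is positively confined if $0<\inf_{i\in\mathbb{J}}\alpha_i\le\sup_{i\in\mathbb{J}}\alpha_i<\infty$. Convention: all series of the form $\sum_{i\in\mathbb{J}}\langle T_ix,T_ix\rangle$ are taken to converge in norm in $\mathcal{A}$ (i.e. $\{T_ix\}_i\in\ell^2(\mathcal{H})$, the Hilbert $\mathcal{A}$-module of sequences $\{x_i\}$ in $\mathcal{H}$ with $\sum_i\langle x_i,x_i\rangle$ norm convergent); this convergence is part of the notion of $K$-operator frame, and an inequality involving such series includes the assertion that the series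 appearing in it converge in norm. *)

(* Defs.v *)
From HB Require Import structures.
From mathcomp Require Import all_boot all_order all_algebra complex.
From mathcomp Require Import all_classical all_reals all_analysis.
Set Implicit Arguments.
Unset Strict Implicit.
Unset Printing Implicit Defensive.
Import Order.TTheory GRing.Theory Num.Theory.
Import numFieldNormedType.Exports.
Local Open Scope classical_set_scope.
Local Open Scope complex_scope.
Local Open Scope ring_scope.

(* [normedModType] cannot be joined with a ring structure (its hierarchy reports
   a missing join with [numDomainType]), so [algType R[i]], which supplies the
   unit (with [1 != 0]), is equipped here with a real-valued norm. *)
HB.mixin Record Algebra_isCStar (R : realType) A of GRing.Algebra R[i] A := {
  cnorm : A -> R ;
  cnorm_eq0 : forall a, cnorm a = 0 -> a = 0 ;
  ler_cnormD : forall a b, cnorm (a + b) <= cnorm a + cnorm b ;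
  cnormZ : forall (z : R[i]) a, cnorm (z *: a) = Normc.normc z * cnorm a ;
  ler_cnormM : forall a b, cnorm (a * b) <= cnorm a * cnorm b ;
  cnorm_complete : forall u : nat -> A,
    (forall e : R, 0 < e -> exists N, forall m n,
       (N <= m)%N -> (N <= n)%N -> cnorm (u m - u n) < e) ->
    exists l, cnorm (u n - l) @[n --> \oo] --> (0 : R) ;
  star : A -> A ;
  starD : forall a b, star (a + b) = star a + star b ;
  starZ : forall (z : R[i]) a, star (z *: a) = Num.conj z *: star a ;
  starM : forall a b, star (a * b) = star b * star a ;
  starK : forall a, star (star a) = a ;
  cnorm_starM : forall a, cnorm (star a * a) = cnorm a ^+ 2 }.

#[short(type="cstarAlgType")]
HB.structure Definition CStarAlgebra (R : realType) :=
  { A of GRing.Algebra R[i] A & Algebra_isCStar R A }.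

Section CStarAlgebraDefs.
Variables (R : realType) (A : cstarAlgType R).
Implicit Types a b : A.

Definition invertible a : Prop := exists b, b * a = 1 /\ a * b = 1.

Definition spectrum a : set R[i] := [set z | ~ invertible (a - z%:A)].

(* In [R[i]], [0 <= z] says that [z] is real and nonnegative. *)
Definition cstar_pos a : Prop :=
  star a = a /\ (forall z, spectrum a z -> 0 <= z).

Definition cstar_le a b : Prop := cstar_pos (b - a).

End CStarAlgebraDefs.

(* The complex vector space structure of a left module over a unital algebra is
   the one given by its scalars, [z x := (z 1) x]; see [scale_real]. *)
HB.mixin Record Lmodule_isHilbert (R : realType) (A : cstarAlgType R) H
    of GRing.Lmodule A H := {
  inner : H -> H -> A ;
  innerDl : forall x y z, inner (x + y) z = inner x z + inner y z ;
  innerZl : forall (a : A) x y, inner (a *: x) y = a * inner x y ;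
  inner_star : forall x y, inner x y = star (inner y x) ;
  inner_pos : forall x, cstar_pos (inner x x) ;
  inner_eq0 : forall x, inner x x = 0 -> x = 0 ;
  hilbert_complete : forall u : nat -> H,
    let dist x y := Num.sqrt (cnorm (inner (x - y) (x - y))) in
    (forall e : R, 0 < e -> exists N, forall m n,
       (N <= m)%N -> (N <= n)%N -> dist (u m) (u n) < e) ->
    exists l, dist (u n) l @[n --> \oo] --> (0 : R) }.

#[short(type="hilbertModType")]
HB.structure Definition HilbertModule (R : realType) (A : cstarAlgType R) :=
  { H of GRing.Lmodule A H & Lmodule_isHilbert R A H }.

Section KOperatorFrames.
Variables (R : realType) (A : cstarAlgType R) (H : hilbertModType A).

(* Adjointable operators; the adjoint is determined by [op]. *)
Record adjointable := Adjointable {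
  op :> H -> H ;
  adj : H -> H ;
  adjP : forall x y, inner (op x) y = inner x (adj y) }.

Definition scale_real (r : R) (x : H) : H := (r%:C%:A : A) *: x.

(* The indices in [J] are summed in increasing order. *)
Definition sq_psum (J : set nat) (f : nat -> H) : nat -> A :=
  fun n => \sum_(0 <= i < n | i \in J) inner (f i) (f i).

(* [s] is the sum, norm convergent in [A], of the series of [<f i, f i>]. *)
Definition is_sq_sum (J : set nat) (f : nat -> H) (s : A) : Prop :=
  cnorm (sq_psum J f n - s) @[n --> \oo] --> (0 : R).

Definition koperator_frame_bounds (K : adjointable) (J : set nat)
    (T : nat -> adjointable) (a b : R) : Prop :=
  [/\ 0 < a, 0 < b &
   forall x : H, exists s : A,
     [/\ is_sq_sum J (fun i => T i x) s,
         cstar_le (a%:C *: inner (adj K x) (adj K x)) s &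
         cstar_le s (b%:C *: inner x x)]].

Definition koperator_frame (K : adjointable) (J : set nat)
    (T : nat -> adjointable) : Prop :=
  exists a b : R, koperator_frame_bounds K J T a b.

End KOperatorFrames.

Definition positively_confined (R : realType) (J : set nat) (al : nat -> R) :
    Prop :=
  let s := [set (al i)%:E | i in J] in
  [/\ (0 < ereal_inf s)%E, (ereal_inf s <= ereal_sup s)%E &
      (ereal_sup s < +oo)%E].

(* Main.v *)
(* Write N_T x for the norm of {al_i T_i x} in the module of square summable
   sequences, and N_S x for that of {be_i S_i x}. The triangle inequality and the
   hypothesis give (1 - mu) N_S <= (1 + lam) N_T and (1 - lam) N_T <= (1 + mu) N_S,
   so the positively confined weights make |sum <S_i x, S_i x>| at most
   C |<x, x>|, and |<K^* x, K^* x>| at most D |sum <S_i x, S_i x>|, for all x.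
   Such norm inequalities between quadratic forms p, q upgrade to p x <= c q x:
   replacing x by h x with h = (q x + e)^(-1/2) gives h (p x) h <= c, and
   conjugating by h^-1 gives p x <= c (q x + e).

   The order on A is handled through the criterion |t - a| <= t for self-adjoint
   a, which is equivalent to having nonnegative spectrum; square roots come from
   the contraction y |-> (q + y^2) / 2, whose fixed point satisfies
   (1 - y)^2 = 1 - q. *)
Require Import Defs.
From HB Require Import structures.
From mathcomp Require Import all_boot all_order all_algebra complex.
From mathcomp Require Import all_classical all_reals all_analysis.
From mathcomp Require Import ring lra.
Set Implicit Arguments.
Unset Strict Implicit.
Unset Printing Implicit Defensive.
Import Order.TTheory GRing.Theory Num.Theory.
Import numFieldNormedType.Exports.
Local Open Scope classical_set_scope.
Local Open Scope ring_scope.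

(** * Norm, scalars and limits in a C*-algebra *)

Section CStarNorm.
Local Open Scope complex_scope.
Variables (R : realType) (A : cstarAlgType R).
Implicit Types (a b q u v x y z : A) (r s t e c : R).

(** Real scalars are viewed as central elements of [A], so that scaling is a product in the ring. *)
Definition cst r : A := r%:C%:A.

Lemma cst0 : cst 0 = 0. Proof. by rewrite /cst rmorph0 scale0r. Qed.

Lemma cst1 : cst 1 = 1. Proof. by rewrite /cst rmorph1 scale1r. Qed.

Lemma cstD r s : cst (r + s) = cst r + cst s.
Proof. by rewrite /cst rmorphD scalerDl. Qed.

Lemma cstN r : cst (- r) = - cst r.
Proof. by rewrite /cst rmorphN scaleNr. Qed.

Lemma cstB r s : cst (r - s) = cst r - cst s.
Proof. by rewrite cstD cstN. Qed.

Lemma cstM r s : cst (r * s) = cst r * cst s.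
Proof. by rewrite /cst rmorphM -scalerA mulr_algl. Qed.

Lemma scale_cst r a : r%:C *: a = cst r * a.
Proof. by rewrite /cst mulr_algl. Qed.

Lemma comm_cst r a : GRing.comm a (cst r).
Proof. exact/commr_sym/comm_alg. Qed.

Lemma cstM2 r x s y : cst r * x * (cst s * y) = cst (r * s) * (x * y).
Proof. by rewrite cstM -!mulrA; congr (_ * _); rewrite !mulrA comm_cst. Qed.

Lemma star0 : star (0 : A) = 0.
Proof. by apply: (@addrI _ (star 0)); rewrite -starD !addr0. Qed.

Lemma starN a : star (- a) = - star a.
Proof. by apply: (@addrI _ (star a)); rewrite -starD !subrr star0. Qed.

Lemma starB a b : star (a - b) = star a - star b.
Proof. by rewrite starD starN. Qed.

Lemma star1 : star (1 : A) = 1.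
Proof.
by rewrite -[LHS]mulr1 -{2}(starK 1) -starM mulr1 starK.
Qed.

Lemma conjC_real r : Num.conj (r%:C) = r%:C.
Proof. exact: conjc_real. Qed.

Lemma star_cst r : star (cst r) = cst r.
Proof. by rewrite /cst starZ star1 conjC_real. Qed.

Lemma normc_real r : Normc.normc r%:C = `|r|.
Proof. by rewrite /= expr0n addr0 sqrtr_sqr. Qed.

Lemma cnorm0 : cnorm (0 : A) = 0.
Proof. by rewrite -[X in cnorm X](scale0r 0) cnormZ Normc.normc0 mul0r. Qed.

Lemma cnormN a : cnorm (- a) = cnorm a.
Proof.
have -> : - a = (-1)%:C *: a by rewrite rmorphN rmorph1 scaleN1r.
by rewrite cnormZ normc_real normrN1 mul1r.
Qed.

Lemma cnorm_distC a b : cnorm (a - b) = cnorm (b - a).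
Proof. by rewrite -cnormN opprB. Qed.

Lemma cnorm_ge0 a : 0 <= cnorm a.
Proof.
have := ler_cnormD a (- a); rewrite subrr cnorm0 cnormN; lra.
Qed.

Lemma ler_cnormB a b : cnorm (a - b) <= cnorm a + cnorm b.
Proof. by have := ler_cnormD a (- b); rewrite cnormN. Qed.

Lemma ler_cnorm_dist y x z : cnorm (x - z) <= cnorm (x - y) + cnorm (y - z).
Proof. by have := ler_cnormD (x - y) (y - z); rewrite subrKA. Qed.

(** [|b|^2 = |b^* b| <= |b^*| |b|] gives [|b| <= |b^*|]; the reverse is the same bound at [b^*]. *)
Lemma cnorm_star a : cnorm (star a) = cnorm a.
Proof.
have le b : cnorm b <= cnorm (star b).
  have := ler_cnormM (star b) b; rewrite cnorm_starM.
  have := cnorm_ge0 b; have := cnorm_ge0 (star b); nra.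
by apply/eqP; rewrite eq_le le andbT -[X in _ <= cnorm X]starK le.
Qed.

Lemma cnorm1 : cnorm (1 : A) = 1.
Proof.
have n0 : cnorm (1 : A) != 0.
  by apply/eqP => /cnorm_eq0/eqP; rewrite oner_eq0.
have := cnorm_starM (1 : A); rewrite star1 mulr1 expr2 => h.
by apply: (mulfI n0); rewrite mulr1 -h.
Qed.

Lemma cnorm_cst r : cnorm (cst r) = `|r|.
Proof. by rewrite cnormZ cnorm1 mulr1 normc_real. Qed.

Lemma cnorm_cstM r a : cnorm (cst r * a) = `|r| * cnorm a.
Proof. by rewrite -scale_cst cnormZ normc_real. Qed.

Lemma cnorm_sq a : star a = a -> cnorm (a * a) = cnorm a ^+ 2.
Proof. by move=> sa; rewrite -cnorm_starM sa. Qed.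

(** * Norm convergence and contractions *)

Definition ccvg (w : nat -> A) a := cnorm (w n - a) @[n --> \oo] --> (0 : R).

Lemma ccvgP (w : nat -> A) a :
  ccvg w a <-> forall e, 0 < e ->
    exists N, forall n, (N <= n)%N -> cnorm (w n - a) < e.
Proof.
split=> [/cvgrPdist_lt h e /h [N _ hN]|h].
  by exists N => n /hN; rewrite sub0r normrN ger0_norm // cnorm_ge0.
apply/cvgrPdist_lt => e /h[N hN]; exists N => // n /= /hN.
by rewrite sub0r normrN ger0_norm // cnorm_ge0.
Qed.

Lemma le_eps r s : (forall e, 0 < e -> r <= s + e) -> r <= s.
Proof. by move=> h; apply/ler_addgt0Pr. Qed.

Lemma ccvg_unique (w : nat -> A) a b : ccvg w a -> ccvg w b -> a = b.
Proof.
move=> /ccvgP ha /ccvgP hb; apply/eqP; rewrite -subr_eq0; apply/eqP.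
apply: cnorm_eq0; apply/eqP; rewrite eq_le cnorm_ge0 andbT.
apply: le_eps => e e0.
have [N hN] := ha _ (divr_gt0 e0 (ltr0Sn _ 1)).
have [M hM] := hb _ (divr_gt0 e0 (ltr0Sn _ 1)).
have := hN _ (leq_maxl N M); have := hM _ (leq_maxr N M).
have := ler_cnorm_dist (w (maxn N M)) a b.
rewrite (cnorm_distC a (w _)); lra.
Qed.

Lemma ccvgD (w w' : nat -> A) a b :
  ccvg w a -> ccvg w' b -> ccvg (fun n => w n + w' n) (a + b).
Proof.
move=> /ccvgP ha /ccvgP hb; apply/ccvgP => e e0.
have [N hN] := ha _ (divr_gt0 e0 (ltr0Sn _ 1)).
have [M hM] := hb _ (divr_gt0 e0 (ltr0Sn _ 1)).
exists (maxn N M) => n; rewrite geq_max => /andP[/hN h1 /hM h2].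
have := ler_cnormD (w n - a) (w' n - b).
rewrite (_ : w n - a + (w' n - b) = w n + w' n - (a + b)); first by lra.
by rewrite opprD addrACA.
Qed.

Lemma ccvg_lip (f : A -> A) c (w : nat -> A) a :
  (forall x y, cnorm (f x - f y) <= c * cnorm (x - y)) ->
  ccvg w a -> ccvg (f \o w) (f a).
Proof.
move=> hf /ccvgP hw; apply/ccvgP => e e0.
have d0 : 0 < `|c| + 1 by have := normr_ge0 c; lra.
have [N hN] := hw _ (divr_gt0 e0 d0).
exists N => n /hN; rewrite ltr_pdivlMr // => h /=.
have := hf (w n) a; have := ler_norm c; have := cnorm_ge0 (w n - a); nra.
Qed.

Lemma ccvgMl b (w : nat -> A) a : ccvg w a -> ccvg (fun n => b * w n) (b * a).
Proof.
apply: (@ccvg_lip _ (cnorm b)) => x y.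
by rewrite -mulrBr ler_cnormM.
Qed.

Lemma ccvgMr b (w : nat -> A) a : ccvg w a -> ccvg (fun n => w n * b) (a * b).
Proof.
apply: (@ccvg_lip (fun x => x * b) (cnorm b)) => x y.
by rewrite -mulrBl mulrC ler_cnormM.
Qed.

Lemma ccvgN (w : nat -> A) a : ccvg w a -> ccvg (fun n => - w n) (- a).
Proof.
apply: (@ccvg_lip _ 1) => x y.
by rewrite -opprD cnormN mul1r.
Qed.

Lemma ccvg_star (w : nat -> A) a : ccvg w a -> ccvg (fun n => star (w n)) (star a).
Proof.
apply: (@ccvg_lip _ 1) => x y.
by rewrite -starB cnorm_star mul1r.
Qed.

Lemma ccvg_ball (w : nat -> A) a r :
  (forall n, cnorm (w n) <= r) -> ccvg w a -> cnorm a <= r.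
Proof.
move=> hw /ccvgP ha; apply: le_eps => e /ha[N /(_ N (leqnn N))].
have := ler_cnormB (w N) (w N - a); rewrite subKr; have := hw N; lra.
Qed.

(** Banach's fixed point theorem on a closed invariant set [P], through which the fixed point
    inherits properties of the iterates such as self-adjointness and commutation. *)
Lemma contraction_fixpoint (P : A -> Prop) (f : A -> A) c x0 :
  0 <= c < 1 -> P x0 -> (forall x, P x -> P (f x)) ->
  (forall (w : nat -> A) a, (forall n, P (w n)) -> ccvg w a -> P a) ->
  (forall x y, P x -> P y -> cnorm (f x - f y) <= c * cnorm (x - y)) ->
  exists2 a, P a & f a = a.
Proof.
move=> /andP[c0 c1] P0 Pf Pcl lf.
pose w n := iter n f x0.
have Pw n : P (w n) by elim: n => //= n IH; exact: Pf.
(* This is the sum of the geometric series of step lengths; the ball of this radius about [x0]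
   contains all iterates. *)
pose B := cnorm (f x0 - x0) / (1 - c).
have hB : c * B + cnorm (f x0 - x0) = B by rewrite /B; field; lra.
have B0 : 0 <= B by rewrite divr_ge0 ?cnorm_ge0 // subr_ge0 ltW.
have wB k : cnorm (w k - x0) <= B.
  elim: k => [|k IH] /=; first by rewrite subrr cnorm0.
  have := ler_cnorm_dist (f x0) (f (w k)) x0; have := lf _ _ (Pw k) P0; nra.
have wd n k : cnorm (w (n + k)%N - w n) <= c ^+ n * B.
  elim: n => [|n IH]; first by rewrite expr0 mul1r; exact: wB.
  rewrite exprS -mulrA; apply: le_trans (lf _ _ (Pw _) (Pw _)) _.
  exact: ler_wpM2l.
have [e|a ha] := @cnorm_complete _ _ w.
  move=> e0; have B1 : 0 < B + 1 by lra.
  have /cvgrPdist_lt : (fun n => c ^+ n) @ \oo --> (0 : R).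
    by apply: cvg_expr; rewrite ger0_norm.
  move=> /(_ _ (divr_gt0 (divr_gt0 e0 (ltr0Sn _ 1)) B1))[N _ hN].
  exists N; have wN n : (N <= n)%N -> cnorm (w n - w N) < e / 2.
    move=> /subnKC <-; apply: le_lt_trans (wd _ _) _.
    have := hN _ (leqnn N).
    rewrite /= sub0r normrN ger0_norm ?exprn_ge0 // ltr_pdivlMr //.
    have : 0 <= c ^+ N by rewrite exprn_ge0.
    lra.
  move=> m n /wN hm /wN hn; have := ler_cnorm_dist (w N) (w m) (w n).
  by rewrite (cnorm_distC (w N) (w n)); lra.
have /ccvgP ha' : ccvg w a by [].
exists a; first exact: Pcl ha.
have Pa : P a by exact: Pcl ha.
(* The shifted iterates [f (w n)] converge both to [f a] and to [a]. *)
apply: (@ccvg_unique (fun n => w n.+1)).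
  apply/ccvgP => e e0; have [N hN] := ha' _ e0; exists N => n /hN h /=.
  have := lf _ _ (Pw n) Pa; have := cnorm_ge0 (w n - a); nra.
apply/ccvgP => e /ha'[N hN]; exists N => n h; exact/hN/leqW.
Qed.
End CStarNorm.

(** * Square roots and positivity *)

Section Positivity.
Local Open Scope complex_scope.
Variables (R : realType) (A : cstarAlgType R).
Implicit Types (a b p q u v x y z : A) (r s t e c : R).

Lemma closed_comm z (w : nat -> A) a :
  (forall n, GRing.comm z (w n)) -> ccvg w a -> GRing.comm z a.
Proof.
move=> h ha; apply: ccvg_unique (ccvgMl z ha) _.
rewrite (_ : (fun _ => _) = fun n => w n * z); first exact: ccvgMr.
by apply/funext => n; exact: h.
Qed.

Lemma closed_star (w : nat -> A) a :
  (forall n, star (w n) = w n) -> ccvg w a -> star a = a.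
Proof.
move=> h ha; apply: ccvg_unique (ccvg_star ha) _.
by rewrite (_ : (fun _ => _) = w) //; apply/funext.
Qed.

(** A fixed point of [y |-> 1 + q * y] is a right inverse of [1 - q]; staying in the closed set of
    elements commuting with [q] makes it a left inverse too. *)
Lemma neumann q : cnorm q < 1 -> invertible (1 - q).
Proof.
move=> q1.
have [|||||y yq hy] := @contraction_fixpoint _ _ (fun y => GRing.comm q y)
    (fun y => 1 + q * y) (cnorm q) q.
- by rewrite cnorm_ge0.
- by [].
- by move=> x h; apply: commrD; [exact: commr1|exact: commrM].
- exact: closed_comm.
- by move=> x y _ _; rewrite opprD addrACA subrr add0r -mulrBr ler_cnormM.
exists y; split.
  by rewrite mulrBr mulr1 -yq -{1}hy addrK.
by rewrite mulrBl mul1r -{1}hy addrK.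
Qed.

(** On the ball of radius [|q|] the map [y |-> (q + y^2) / 2] has Lipschitz constant [|q|], since
    [x^2 - y^2 = x (x - y) + (x - y) y]. The bound on [y] later makes [1 - y] invertible. *)
Lemma sqrt_1sub q : star q = q -> cnorm q < 1 ->
  exists y, [/\ cnorm y <= cnorm q, star y = y,
    forall z, GRing.comm z q -> GRing.comm z y & (1 - y) * (1 - y) = 1 - q].
Proof.
move=> sq q1; have q0 := cnorm_ge0 q.
have h2 x : cst A 2^-1 * (x + x) = x.
  by rewrite mulrDr -mulrDl -cstD (_ : 2^-1 + 2^-1 = 1 :> R) ?cst1 ?mul1r //; field.
have [|||||y [y1 y2 y3] hy] := @contraction_fixpoint _ _
    (fun y => [/\ cnorm y <= cnorm q, star y = y &
      forall z, GRing.comm z q -> GRing.comm z y])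
    (fun y => cst A 2^-1 * (q + y * y)) (cnorm q) q.
- by rewrite q0.
- by [].
- move=> y [y1 y2 y3]; split.
  + rewrite cnorm_cstM ger0_norm ?invr_ge0 ?ler0n //.
    have := ler_cnormD q (y * y); have := ler_cnormM y y; have := cnorm_ge0 y.
    nra.
  + by rewrite starM star_cst starD starM y2 sq -comm_cst.
  + move=> z zq; apply: commrM; first exact: comm_cst.
    by apply: commrD => //; apply: commrM; exact: y3.
- move=> w a hw ha; split.
  + by apply: ccvg_ball ha => n; have [] := hw n.
  + by apply: closed_star ha => n; have [] := hw n.
  + by move=> z zq; apply: closed_comm ha => n; have [_ _] := hw n; apply.
- move=> x y [x1 _ _] [y1 _ _]; rewrite -mulrBr cnorm_cstM.
  rewrite ger0_norm ?invr_ge0 ?ler0n //.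
  rewrite (_ : q + x * x - (q + y * y) = x * (x - y) + (x - y) * y); last first.
    by rewrite opprD addrACA subrr add0r mulrBr mulrBl subrKA.
  have := ler_cnormD (x * (x - y)) ((x - y) * y).
  have := ler_cnormM x (x - y); have := ler_cnormM (x - y) y.
  have := cnorm_ge0 x; have := cnorm_ge0 y; have := cnorm_ge0 (x - y); nra.
exists y; split=> //.
have qy : q + y * y = y + y.
  by rewrite -{3 4}hy -mulrDr h2.
rewrite mulrBr mulr1 mulrBl mul1r opprB addrA addrAC.
by rewrite -[_ - _ - y]addrA -opprD -qy opprD addrA subrK.
Qed.

(** * Invertible elements, square roots and the positive cone *)

Lemma invertibleM a b : invertible a -> invertible b -> invertible (a * b).
Proof.
move=> [x [xa ax]] [y [yb By]]; exists (y * x); split.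
  by rewrite mulrA -(mulrA y) xa mulr1.
by rewrite mulrA -(mulrA a) By mulr1.
Qed.

(** If [x] inverts [a b], then [b x] is a right inverse of [a] and [x b] a left one, so they
    agree. *)
Lemma invertible_commMl a b : GRing.comm a b -> invertible (a * b) -> invertible a.
Proof.
move=> ab [x [xl xr]].
have xra : a * (b * x) = 1 by rewrite mulrA.
have xla : (x * b) * a = 1 by rewrite -mulrA -ab.
exists (b * x); split=> //.
by rewrite -[b * x]mul1r -xla -(mulrA (x * b) a) xra mulr1.
Qed.

Lemma inverse_comm a x z : x * a = 1 -> a * x = 1 ->
  GRing.comm z a -> GRing.comm z x.
Proof.
move=> xa ax za; rewrite /GRing.comm -[RHS]mulr1 -ax.
by rewrite mulrA -[x * z * a]mulrA za [x * (a * z)]mulrA xa mul1r.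
Qed.

Lemma inverse_star a x : x * a = 1 -> a * x = 1 -> star a = a -> star x = x.
Proof.
move=> xa ax sa; rewrite -[star x]mulr1 -ax mulrA -{1}sa -starM ax star1.
by rewrite mul1r.
Qed.

Lemma invertible_cst r : r != 0 -> invertible (cst A r).
Proof.
by move=> r0; exists (cst A r^-1); rewrite -!cstM mulVf // mulfV // cst1.
Qed.

Lemma cnorm_sub_gt0 t a : cnorm (cst A t - a) < t -> 0 < t.
Proof. by have := cnorm_ge0 (cst A t - a); lra. Qed.

(** The root is [sqrt t (1 - y)], where [(1 - y)^2 = 1 - q] and [a = t (1 - q)]; the norm hypothesis
    amounts to [|q| < 1]. *)
Lemma csqrt t a : star a = a -> cnorm (cst A t - a) < t ->
  exists u, [/\ star u = u, u * u = a,
    forall z, GRing.comm z a -> GRing.comm z u & invertible u].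
Proof.
move=> sa ht; have t0 := cnorm_sub_gt0 ht; have tn0 := lt0r_neq0 t0.
pose q := 1 - cst A t^-1 * a.
have tq : cst A t * q = cst A t - a.
  by rewrite mulrBr mulr1 mulrA -cstM mulfV // cst1 mul1r.
have q1 : cnorm q < 1.
  by move: ht; rewrite -tq cnorm_cstM gtr0_norm // gtr_pMr.
have sq : star q = q by rewrite starB star1 starM star_cst sa comm_cst.
have [y [y1 y2 y3 y4]] := sqrt_1sub sq q1.
exists (cst A (Num.sqrt t) * (1 - y)); split.
- by rewrite starM star_cst starB star1 y2 -comm_cst.
- rewrite cstM2 -expr2 sqr_sqrtr ?ltW // y4 /q subKr mulrA -cstM mulfV //.
  by rewrite cst1 mul1r.
- move=> z za; apply: commrM; first exact: comm_cst.
  apply: commrB; first exact: commr1.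
  apply: y3; apply: commrB; first exact: commr1.
  by apply: commrM => //; exact: comm_cst.
apply: invertibleM; last by apply: neumann; exact: le_lt_trans q1.
by apply: invertible_cst; rewrite gt_eqF // sqrtr_gt0.
Qed.

(* [(u + iv) / sqrt c] is unitary, and [u] is the real part of [u + iv]. *)
Lemma cnorm_re u v c : 0 <= c -> star u = u -> star v = v -> GRing.comm u v ->
  u * u + v * v = cst A c -> cnorm u ^+ 2 <= c.
Proof.
move=> c0 su sv uv huv.
have i2 : (('i%C : R[i]) * 'i%C = -1) by rewrite -expr2 sqr_i.
pose x := u + 'i%C *: v.
have sx : star x = u - 'i%C *: v.
  by rewrite starD starZ su sv -scaleNr complexiE conjCi.
have xx : star x * x = cst A c.
  rewrite sx mulrDr !mulrBl -!scalerAl -!scalerAr scalerA i2 scaleN1r.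
  by rewrite opprK -huv -uv addrA subrK.
have nx : cnorm x ^+ 2 = c by rewrite -cnorm_starM xx cnorm_cst ger0_norm.
have xu : x + star x = cst A 2 * u.
  by rewrite sx addrACA subrr addr0 -mulr2n -scale_cst rmorphMn scaler_nat.
have := ler_cnormD x (star x); rewrite cnorm_star xu cnorm_cstM normr_nat.
have := cnorm_ge0 x; have := cnorm_ge0 u; nra.
Qed.

(* The norm form of positivity, equivalent to the spectral one, [cstar_posE]. *)
Definition npos a : Prop :=
  star a = a /\ exists t, cnorm (cst A t - a) <= t.

(** Adding [e] turns [|t - a| <= t] into the strict bound that [csqrt] asks for, at [t + e]. *)
Lemma npos_sqrt a e : npos a -> 0 < e ->
  exists u, [/\ star u = u, u * u = a + cst A e,
    forall z, GRing.comm z a -> GRing.comm z u & invertible u].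
Proof.
move=> [sa [t ht]] e0; have [||u [u1 u2 u3 u4]] := @csqrt (t + e) (a + cst A e).
- by rewrite starD sa star_cst.
- by rewrite cstD opprD addrACA subrr addr0; lra.
exists u; split=> // z za; apply: u3; apply: commrD => //; exact: comm_cst.
Qed.

(** Commuting roots [u] of [a + e] and [v] of [t + 2 e - (a + e)] satisfy [u^2 + v^2 = t + 2 e],
    whence [|v^2| <= t + 2 e] by [cnorm_re]; then [e] tends to 0. So any bound on [|a|] can serve as
    the [t] in [npos]. *)
Lemma npos_le a t : npos a -> cnorm a <= t -> cnorm (cst A t - a) <= t.
Proof.
move=> ha hat; have t0 : 0 <= t by apply: le_trans hat; exact: cnorm_ge0.
apply: le_eps => e' e'0; pose e := e' / 3; have e0 : 0 < e by rewrite divr_gt0.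
have ee : e' = 3 * e by rewrite /e; field.
have [u [su uu cu _]] := npos_sqrt ha e0.
have ne : cnorm (cst A e) = e by rewrite cnorm_cst gtr0_norm.
(* The shift [2 e] gives the strict bound [|a + e| <= t + e < t + 2 e]. *)
have [||v [sv vv cv _]] := @csqrt (t + 2 * e) (cst A (t + 2 * e) - (a + cst A e)).
- by rewrite starB star_cst starD star_cst ha.1.
- by rewrite subKr; have := ler_cnormD a (cst A e); lra.
have v2 : cnorm v ^+ 2 <= t + 2 * e.
  apply: (@cnorm_re _ u) => //; first lra; last by rewrite vv uu subrK.
  apply/commr_sym/cv; apply: commrB; first exact: comm_cst.
  by rewrite -uu; apply: commrM; exact: commr_refl.
rewrite -cnorm_sq // vv in v2.
have -> : cst A t - a = cst A (t + 2 * e) - (a + cst A e) - cst A e.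
  rewrite -addrA -opprD -addrA -cstD (_ : e + e = 2 * e); last by ring.
  by rewrite (cstD A t) opprD addrACA subrr addr0.
have := ler_cnormB (cst A (t + 2 * e) - (a + cst A e)) (cst A e); lra.
Qed.

Lemma npos_star a : npos a -> star a = a. Proof. by case. Qed.

(** With [t = |u^2| + 1], a root [v] of [t - u^2] commutes with [u], and [cnorm_re] gives
    [|t - u^2| = |v|^2 <= t]. *)
Lemma npos_sq u : star u = u -> npos (u * u).
Proof.
move=> su; split; first by rewrite starM su.
have t0 : 0 <= cnorm (u * u) + 1 by have := cnorm_ge0 (u * u); lra.
exists (cnorm (u * u) + 1).
have [||v [sv vv cv _]] :=
  @csqrt (cnorm (u * u) + 1) (cst A (cnorm (u * u) + 1) - u * u).
- by rewrite starB star_cst starM su.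
- by rewrite subKr; lra.
rewrite -vv cnorm_sq //; apply: (@cnorm_re _ u) => //; last by rewrite vv subrK.
apply/commr_sym/cv; apply: commrB; first exact: comm_cst.
by apply: commrM; exact: commr_refl.
Qed.

(** The radii [s] and [t] add up: in the norm form, sums of positive elements are a matter of the
    triangle inequality. *)
Lemma nposD a b : npos a -> npos b -> npos (a + b).
Proof.
move=> [sa [s hs]] [sb [t ht]]; split; first by rewrite starD sa sb.
exists (s + t); have := ler_cnormD (cst A s - a) (cst A t - b).
by rewrite cstD opprD addrACA; lra.
Qed.

Lemma npos_cst r : 0 <= r -> npos (cst A r).
Proof.
by move=> r0; split; [exact: star_cst|exists r; rewrite subrr cnorm0].
Qed.

Lemma nposZ r a : 0 <= r -> npos a -> npos (cst A r * a).
Proof.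
move=> r0 [sa [t ht]]; split; first by rewrite starM star_cst sa comm_cst.
exists (r * t); rewrite cstM -mulrBr cnorm_cstM ger0_norm //.
exact: ler_wpM2l.
Qed.

Lemma npos_ball a r : star a = a -> cnorm a <= r -> npos (cst A r - a).
Proof.
by move=> sa ar; split; [rewrite starB star_cst sa|exists r; rewrite subKr].
Qed.

Lemma npos_invertible a s : npos a -> 0 < s -> invertible (a + cst A s).
Proof.
move=> ha s0; have [u [_ <- _ iu]] := npos_sqrt ha s0.
exact: invertibleM.
Qed.

(** By [npos_le], the one radius [|a| + 1] serves all [a + d] with [d <= 1], so [d] can tend to
    0. *)
Lemma npos_eps a : (forall e, 0 < e -> npos (a + cst A e)) -> npos a.
Proof.
move=> h; split.
  have := npos_star (h 1 ltr01); rewrite starD star_cst; exact: addIr.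
exists (cnorm a + 1); apply: le_eps => e e0.
pose d := Num.min e 1; have d0 : 0 < d by rewrite lt_min e0 ltr01.
have d1 : d <= 1 by rewrite ge_min lexx orbT.
have de : d <= e by rewrite ge_min lexx.
have nd : cnorm (cst A d) = d by rewrite cnorm_cst gtr0_norm.
have := @npos_le _ (cnorm a + 1) (h d d0).
have := ler_cnormD a (cst A d) => h1 /(_ ltac:(lra)) h2.
have := ler_cnormD (cst A (cnorm a + 1) - (a + cst A d)) (cst A d).
rewrite opprD addrA subrK -addrA -opprD; lra.
Qed.

(* With [k = (p + e)^-1], [p - e = (p + e) (1 - 2 e k)] is a product of two
   commuting squares; the choice of [e] keeps [k] bounded by [2 |p^-1|]. *)
Lemma npos_sub_cst p : npos p -> invertible p ->
  exists2 e, 0 < e & npos (p - cst A e).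
Proof.
move=> hp [j [jp pj]].
pose e := (8 * (cnorm j + 1))^-1.
have j0 := cnorm_ge0 j.
have e8 : e * (8 * (cnorm j + 1)) = 1 by rewrite mulVf // gt_eqF //; lra.
have e0 : 0 < e by rewrite invr_gt0; lra.
exists e => //.
have [u [su uu cu _]] := npos_sqrt hp e0.
have [k [kl kr]] := npos_invertible hp e0.
have sk : star k = k by apply: inverse_star kl kr _; rewrite starD star_cst hp.1.
have kE : k = j - cst A e * (j * k).
  rewrite -[X in X - _](mulr1 j) -kr mulrDl mulrDr mulrA jp mul1r.
  by rewrite !mulrA comm_cst addrK.
have k2 : cnorm k <= 2 * cnorm j.
  have := ler_cnormB j (cst A e * (j * k)); rewrite -kE cnorm_cstM gtr0_norm //.
  have := ler_cnormM j k; have := cnorm_ge0 k; nra.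
(* Since [2 e |k| <= 4 e |j| < 1], the element [1 - 2 e k] is close enough to the unit to have a
   root. *)
have [||w [sw ww cw _]] := @csqrt 1 (1 - cst A (2 * e) * k).
- by rewrite starB star1 starM star_cst sk comm_cst.
- rewrite cst1 subKr cnorm_cstM ger0_norm; last by lra.
  by have := cnorm_ge0 k; nra.
have uk : GRing.comm u k.
  apply: inverse_comm kl kr _.
  by rewrite -uu; apply: commrM; exact: commr_refl.
have uw : GRing.comm u w.
  apply: cw; apply: commrB; first exact: commr1.
  by apply: commrM => //; exact: comm_cst.
have -> : p - cst A e = (u * w) * (u * w).
  rewrite mulrA -[u * w * u]mulrA -uw mulrA uu -mulrA ww mulrBr mulr1.
  rewrite mulrA comm_cst -mulrA kr mulr1 -addrA -cstB.
  by rewrite (_ : e - 2 * e = - e) ?cstN //; ring.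
by apply: npos_sq; rewrite starM su sw -uw.
Qed.

Lemma npos_shift a s t : npos (a + cst A s) -> s <= t -> npos (a + cst A t).
Proof.
move=> h st; rewrite -(subrKC s t) cstD addrA.
by apply: nposD => //; apply: npos_cst; rewrite subr_ge0.
Qed.

(* If the infimum of the [s >= 0] with [a + s] positive were positive, it could
   be lowered by [npos_sub_cst]. *)
Lemma npos_spectral a : star a = a ->
  (forall s, 0 < s -> invertible (a + cst A s)) -> npos a.
Proof.
move=> sa hi.
pose E := [set s | 0 < s /\ npos (a + cst A s)].
have E0 : E (cnorm a + 1).
  split; first by have := cnorm_ge0 a; lra.
  rewrite addrC -[a]opprK; apply: npos_ball; first by rewrite starN sa.
  by rewrite !cnormN; lra.
have lE : has_inf E.
  by split; [exists (cnorm a + 1)|exists 0 => s [/ltW]].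
have up s t : E s -> s <= t -> E t.
  move=> [s0 h] st; split; first exact: lt_le_trans st.
  exact: npos_shift h st.
have inE s : inf E < s -> E s.
  move=> hs; have [t Et ts] := inf_lt lE.1 hs.
  exact: up Et (ltW ts).
have m0 : 0 <= inf E by apply: lb_le_inf => [|s [/ltW]//]; exists (cnorm a + 1).
have am : npos (a + cst A (inf E)).
  apply: npos_eps => e e0; rewrite -addrA -cstD.
  by apply: (inE _ _).2; rewrite ltrDl.
have [mp|mn] := ltP 0 (inf E); last first.
  have m00 : inf E = 0 by apply/eqP; rewrite eq_le mn.
  by move: am; rewrite m00 cst0 addr0.
have [e e0] := npos_sub_cst am (hi _ mp).
rewrite -addrA -cstB => he.
(* [E] contains only positive numbers; the second term keeps the candidate positive when [inf E - e]
   is not. *)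
have Em : E (Num.max (inf E - e) (inf E / 2)).
  split; first by rewrite lt_max divr_gt0 ?orbT.
  by apply: npos_shift he _; rewrite le_max lexx.
have := ge_inf lE.2 Em; rewrite le_max => /orP[]; lra.
Qed.

(** Forward, no [- s] with [s > 0] lies in the spectrum, which is what [npos_spectral] asks for.
    Backward, non-real points and negative real points are excluded separately. *)
Lemma cstar_posE a : cstar_pos a <-> npos a.
Proof.
split=> [[sa ha]|ha].
  apply: npos_spectral => // s s0.
  case: (pselect (invertible (a + cst A s))) => // /= ni.
  have := ha (- s%:C); rewrite /spectrum /= scaleNr opprK => /(_ ni).
  by rewrite lecE /= oppr_ge0 leNgt s0 andbF.
split; first exact: ha.1.
(* [(b - iy) (b + iy) = b ^ 2 + y ^ 2] is invertible for [b] self-adjoint. *)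
move=> [x y]; rewrite /spectrum /= lecE /= => ni.
pose w : A := 'i%C *: cst A y.
have zE : (x +i* y)%:A = cst A x + w.
  by rewrite /w /cst scalerA -scalerDl; congr (_ *: _); simpc.
have ww : w * w = - cst A (y * y).
  by rewrite /w -scalerAl -scalerAr scalerA -expr2 sqr_i scaleN1r cstM.
have y0 : y = 0.
  apply: contra_notP ni => /eqP y0; rewrite zE opprD addrA.
  set b := a - cst A x; have bw : GRing.comm b w.
    by rewrite /w /cst scalerA; exact/commr_sym/comm_alg.
  apply: (@invertible_commMl _ (b + w)).
    by apply: commrD; apply/commr_sym; apply: commrB.
  rewrite mulrDr (mulrBl b b w) (mulrBl w b w) bw addrA subrK ww opprK.
  apply: npos_invertible; last by rewrite -expr2 exprn_even_gt0.
  by apply: npos_sq; rewrite starB star_cst ha.1.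
rewrite y0 eqxx /= leNgt; apply: contra_notN ni => x0.
have -> : (x +i* y)%:A = cst A x by rewrite y0.
by rewrite -cstN; apply: npos_invertible; rewrite ?oppr_gt0.
Qed.

(* [b p b + s = b (p + s b^-2) b], and [s b^-2] is bounded below. *)
Lemma npos_conj b p : star b = b -> invertible b -> npos p -> npos (b * p * b).
Proof.
move=> sb [d [db bd]] hp; apply: npos_spectral => [|s s0].
  by rewrite !starM sb hp.1 mulrA.
have sd : star d = d by exact: inverse_star db bd sb.
have id : invertible d by exists b.
have is0 : invertible (cst A s) by apply: invertible_cst; rewrite gt_eqF.
have hdd : npos (cst A s * (d * d)) by apply: nposZ (ltW s0) (npos_sq sd).
have [e e0 he] := npos_sub_cst hdd (invertibleM is0 (invertibleM id id)).
have -> : b * p * b + cst A s = b * (p + cst A s * (d * d)) * b.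
  rewrite mulrDr mulrDl; congr (_ + _).
  by rewrite mulrA comm_cst -!mulrA db mulr1 bd mulr1.
apply: invertibleM; last by exists d.
apply: invertibleM; first by exists d.
rewrite -[cst A s * _](subrK (cst A e)) addrA.
exact: npos_invertible (nposD hp he) e0.
Qed.

(** * Order, norm and limits of positive elements *)

Lemma npos_cst_ge0 c : npos (cst A c) -> 0 <= c.
Proof.
move=> [_ [t]]; rewrite -cstB cnorm_cst; have := ler_norm (t - c); lra.
Qed.

(** Commuting roots of [p + e] and [c - p + e] have squares adding up to [c + 2 e], so [cnorm_re]
    bounds [|p + e|]. *)
Lemma cnorm_le_cst p c : npos p -> npos (cst A c - p) -> cnorm p <= c.
Proof.
move=> hp hq.
have c0 : 0 <= c by apply: npos_cst_ge0; rewrite -(subrKC p (cst A c)); apply: nposD.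
apply: le_eps => e' e'0; pose e := e' / 3; have e0 : 0 < e by rewrite divr_gt0.
have ee : e' = 3 * e by rewrite /e; field.
have [u [su uu cu _]] := npos_sqrt hp e0.
have [v [sv vv cv _]] := npos_sqrt hq e0.
have u2 : cnorm u ^+ 2 <= c + 2 * e.
  apply: (@cnorm_re _ v) => //; first lra.
    apply: cv; apply: commrB; first exact: comm_cst.
    by apply/commr_sym/cu/commr_refl.
  rewrite uu vv addrACA subrKC -!cstD; congr cst; ring.
rewrite -cnorm_sq // uu in u2.
have := ler_cnormB (p + cst A e) (cst A e).
rewrite addrK cnorm_cst gtr0_norm //; lra.
Qed.

(** The chain [p <= q <= |q|] reduces the claim to the scalar bound. *)
Lemma cnorm_le_npos p q : npos p -> npos (q - p) -> cnorm p <= cnorm q.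
Proof.
move=> hp hqp; apply: cnorm_le_cst => //.
rewrite -(subrKA q); apply: nposD => //; apply: npos_ball => //.
by rewrite -(subrK p q) starD hp.1 hqp.1.
Qed.

Lemma cnorm_le_nposZ p q c : 0 <= c -> npos p -> npos (cst A c * q - p) ->
  cnorm p <= c * cnorm q.
Proof.
by move=> c0 hp /(cnorm_le_npos hp); rewrite cnorm_cstM ger0_norm.
Qed.

(** [a + e] is the positive [w N] plus [e - (w N - a)], which is positive once [|w N - a| <= e]. *)
Lemma closed_npos (w : nat -> A) a : (forall n, npos (w n)) -> ccvg w a -> npos a.
Proof.
move=> hw ha; have sa : star a = a.
  by apply: closed_star ha => n; exact: (hw n).1.
apply: npos_eps => e e0; have [N hN] := (ccvgP _ _).1 ha _ e0.
have h : cnorm (w N - a) <= e by apply/ltW/hN.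
have -> : a + cst A e = w N + (cst A e - (w N - a)).
  by rewrite opprB addrCA subrKC addrC.
apply: nposD => //; apply: npos_ball => //.
by rewrite starB sa (hw N).1.
Qed.

(* Test the hypothesis with [h = (q + e)^(-1/2)], for which [h q h <= 1]. *)
Lemma npos_of_conj_cnorm p q c : star p = p -> npos q -> 0 <= c ->
  (forall h, star h = h -> cnorm (h * p * h) <= c * cnorm (h * q * h)) ->
  npos (cst A c * q - p).
Proof.
move=> sp hq c0 hpq; apply: npos_eps => e' e'0.
(* Conjugating back will give [p <= c (q + e)], and [c e <= e']; the [+ 1] avoids a division by
   0. *)
pose e := e' / (c + 1); have e0 : 0 < e by rewrite divr_gt0 //; lra.
have ee : e * (c + 1) = e' by rewrite /e divfK // gt_eqF //; lra.
have [u [su uu _ [d [du ud]]]] := npos_sqrt hq e0.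
have sd : star d = d by exact: inverse_star du ud su.
have id : invertible d by exists u.
have dqd : d * q * d = 1 - cst A e * (d * d).
  rewrite -[q](addrK (cst A e)) -uu mulrBr mulrBl; congr (_ - _).
    by rewrite mulrA du mul1r ud.
  by rewrite comm_cst mulrA.
have q1 : cnorm (d * q * d) <= 1.
  apply: cnorm_le_cst; first exact: npos_conj.
  by rewrite dqd cst1 subKr; apply: nposZ (ltW e0) (npos_sq sd).
have dpd : npos (cst A c - d * p * d).
  apply: npos_ball; first by rewrite !starM sd sp mulrA.
  by apply: le_trans (hpq d sd) _; rewrite ler_piMr.
have := npos_conj su (ex_intro _ d (conj du ud)) dpd.
rewrite mulrBr mulrBl.
have -> : u * (d * p * d) * u = p.
  by rewrite !mulrA ud mul1r -mulrA du mulr1.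
rewrite comm_cst -mulrA uu mulrDr -cstM => h.
have := nposD h (npos_cst (_ : 0 <= e' - c * e)).
rewrite subr_ge0 => /(_ ltac:(lra)).
by rewrite cstB addrAC -(addrA _ (cst A (c * e))) subrKC addrAC.
Qed.
End Positivity.

(** * Square summable sequences in a Hilbert module *)

Section HilbertModule.
Variables (R : realType) (A : cstarAlgType R) (H : hilbertModType A).
Implicit Types (h : A) (x y z : H) (r c t : R) (J : set nat) (f g : nat -> H).

Lemma innerNl x y : inner (- x) y = - inner x y.
Proof. by rewrite -scaleN1r innerZl mulN1r. Qed.

Lemma innerBl x y z : inner (x - y) z = inner x z - inner y z.
Proof. by rewrite innerDl innerNl. Qed.

Lemma innerDr x y z : inner x (y + z) = inner x y + inner x z.
Proof. by rewrite inner_star innerDl starD -!inner_star. Qed.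

Lemma innerNr x y : inner x (- y) = - inner x y.
Proof. by rewrite inner_star innerNl starN -inner_star. Qed.

Lemma innerZr h x y : inner x (h *: y) = inner x y * star h.
Proof. by rewrite inner_star innerZl starM -inner_star. Qed.

Lemma inner_inj x y : (forall z, inner x z = inner y z) -> x = y.
Proof.
move=> e; apply/eqP; rewrite -subr_eq0; apply/eqP/inner_eq0.
by rewrite innerBl e subrr.
Qed.

Lemma npos_inner x : npos (inner x x).
Proof. exact/cstar_posE/inner_pos. Qed.

Lemma inner_sqZ h x : inner (h *: x) (h *: x) = h * inner x x * star h.
Proof. by rewrite innerZl innerZr mulrA. Qed.

Lemma inner_scale_real r x :
  inner (scale_real r x) (scale_real r x) = cst A (r ^+ 2) * inner x x.
Proof.
rewrite /scale_real -/(cst A r) inner_sqZ star_cst.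
by rewrite comm_cst mulrA -cstM -expr2.
Qed.

(** This bound and the next turn bounds on the weights into termwise comparisons of weighted and
    unweighted series. *)
Lemma inner_scale_real_le r c x : r ^+ 2 <= c ->
  npos (cst A c * inner x x - inner (scale_real r x) (scale_real r x)).
Proof.
move=> rc; rewrite inner_scale_real -mulrBl -cstB.
by apply: nposZ (npos_inner x); rewrite subr_ge0.
Qed.

Lemma inner_scale_real_ge r c x : 1 <= c * r ^+ 2 ->
  npos (cst A c * inner (scale_real r x) (scale_real r x) - inner x x).
Proof.
move=> rc; rewrite inner_scale_real mulrA -cstM -[X in _ - X]mul1r -cst1 -mulrBl.
by rewrite -cstB; apply: nposZ (npos_inner x); rewrite subr_ge0.
Qed.

(** Linearity comes from the adjoint: both sides have the same inner product with every [z]. *)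
Lemma opZ (T : adjointable H) h x : T (h *: x) = h *: T x.
Proof. by apply: inner_inj => z; rewrite adjP !innerZl adjP. Qed.

Lemma adjZ (T : adjointable H) h x : adj T (h *: x) = h *: adj T x.
Proof.
apply: inner_inj => z; rewrite inner_star [RHS]inner_star; congr star.
by rewrite -adjP !innerZr adjP.
Qed.

(* The difference is the square of [sqrt t x - y / sqrt t]. *)
Lemma inner_sqD_le t x y : 0 < t ->
  npos (cst A (1 + t) * inner x x + cst A (1 + t^-1) * inner y y
        - inner (x + y) (x + y)).
Proof.
move=> t0; pose s := Num.sqrt t.
have s0 : s != 0 by rewrite gt_eqF // sqrtr_gt0.
have ss : s ^+ 2 = t by rewrite sqr_sqrtr // ltW.
have := npos_inner (scale_real s x - scale_real s^-1 y).
have -> : inner (scale_real s x - scale_real s^-1 y)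
    (scale_real s x - scale_real s^-1 y) = cst A t * inner x x - inner x y
    - inner y x + cst A t^-1 * inner y y.
  rewrite innerDl !innerDr !innerNl !innerNr !inner_scale_real opprK.
  rewrite exprVn ss /scale_real -!/(cst A _) !innerZl !innerZr !star_cst.
  rewrite !comm_cst !mulrA -!cstM mulfV // mulVf // cst1 !mul1r.
  by rewrite addrA.
rewrite innerDl !innerDr !cstD !mulrDl cst1 !mul1r.
set a := inner x x; set b := inner y y; set ab := inner x y.
set ba := inner y x; set ta := _ * a; set tb := _ * b.
suff -> : a + ta + (b + tb) - (a + ab + (ba + b)) = ta - ab - ba + tb by [].
rewrite [ba + b]addrC [a + ab + _]addrACA [a + ta]addrC [b + tb]addrC.
rewrite [ta + a + _]addrACA addrKA opprD addrA.
by rewrite (addrAC ta tb) [LHS]addrAC.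
Qed.

(** * Series of squares: comparison and triangle inequality *)

Lemma sq_psum_npos J f n : npos (sq_psum J f n).
Proof.
apply: (big_ind (@npos R A)) => [|a b|i _].
- by rewrite -cst0; exact: npos_cst.
- exact: nposD.
- exact: npos_inner.
Qed.

Lemma is_sq_sum_npos J f (s : A) : is_sq_sum J f s -> npos s.
Proof. by apply: closed_npos => n; exact: sq_psum_npos. Qed.

Lemma is_sq_sumN J f (s : A) : is_sq_sum J f s -> is_sq_sum J (fun i => - f i) s.
Proof.
rewrite /is_sq_sum (_ : sq_psum J _ = sq_psum J f) //; apply/funext => n.
by apply: eq_bigr => i _; rewrite innerNl innerNr opprK.
Qed.

Lemma is_sq_sumZ J f (s : A) h :
  is_sq_sum J f s -> is_sq_sum J (fun i => h *: f i) (h * s * star h).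
Proof.
move=> hf; rewrite /is_sq_sum.
have -> : sq_psum J (fun i => h *: f i) = fun n => h * sq_psum J f n * star h.
  apply/funext => n; rewrite /sq_psum mulr_sumr mulr_suml.
  by apply: eq_bigr => i _; rewrite inner_sqZ.
exact: (ccvgMr (star h) (ccvgMl h hf)).
Qed.

Lemma sum_npos_le J f g c m n :
  (forall i, i \in J -> npos (cst A c * inner (g i) (g i) - inner (f i) (f i))) ->
  npos (cst A c * (\sum_(m <= i < n | i \in J) inner (g i) (g i))
        - \sum_(m <= i < n | i \in J) inner (f i) (f i)).
Proof.
move=> fg; rewrite mulr_sumr -sumrB; apply: (big_ind (@npos R A)) => // [|a b].
- by rewrite -cst0; exact: npos_cst.
- exact: nposD.
Qed.

Lemma is_sq_sum_le J f g c (s t : A) :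
  (forall i, i \in J -> npos (cst A c * inner (g i) (g i) - inner (f i) (f i))) ->
  is_sq_sum J f s -> is_sq_sum J g t -> npos (cst A c * t - s).
Proof.
move=> fg hs ht.
apply: closed_npos (ccvgD (ccvgMl (cst A c) ht) (ccvgN hs)) => n.
exact: sum_npos_le.
Qed.

(** Blocks of the [f] series are dominated by [c] times those of the [g] series, hence also in norm,
    so the partial sums are Cauchy. *)
Lemma is_sq_sum_comparison J f g c (t : A) : 0 <= c ->
  (forall i, i \in J -> npos (cst A c * inner (g i) (g i) - inner (f i) (f i))) ->
  is_sq_sum J g t -> exists s : A, is_sq_sum J f s.
Proof.
move=> c0 fg /ccvgP hg; apply: cnorm_complete => e e0.
(* Two partial sums of [g] within [e / (2 (c + 1))] of [t] differ by less than [e / (c + 1)]; the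
   factor [c] then leaves less than [e]. *)
have c1 : 0 < 2 * (c + 1) by lra.
have [N hN] := hg _ (divr_gt0 e0 c1).
have psumB k l (F : nat -> H) : (k <= l)%N -> sq_psum J F l - sq_psum J F k =
    \sum_(k <= i < l | i \in J) inner (F i) (F i).
  by move=> kl; rewrite /sq_psum (big_cat_nat (leq0n k) kl) /= addrC addrK.
have main k l : (N <= k)%N -> (k <= l)%N ->
    cnorm (sq_psum J f l - sq_psum J f k) < e.
  move=> Nk kl; rewrite psumB //.
  apply: (@le_lt_trans _ _
      (cnorm (cst A c * (\sum_(k <= i < l | i \in J) inner (g i) (g i))))).
    apply: cnorm_le_npos; last exact: sum_npos_le.
    apply: (big_ind (@npos R A)) => [|a b|i _].
    - by rewrite -cst0; exact: npos_cst.
    - exact: nposD.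
    - exact: npos_inner.
  rewrite cnorm_cstM ger0_norm // -psumB //.
  have := hN _ Nk; have := hN _ (leq_trans Nk kl); rewrite !ltr_pdivlMr //.
  have := ler_cnorm_dist t (sq_psum J g l) (sq_psum J g k).
  rewrite (cnorm_distC t).
  have := cnorm_ge0 (sq_psum J g l - t); have := cnorm_ge0 (sq_psum J g k - t).
  have := cnorm_ge0 (sq_psum J g l - sq_psum J g k).
  nra.
exists N => m n Nm Nn; have [mn|/ltnW nm] := leqP m n; last exact: main.
by rewrite cnorm_distC; exact: main.
Qed.

(* The infimum over [t] is attained at [t = s / r]; perturbing by [e] covers
   [r = 0] and [s = 0]. *)
Lemma le_sqrD r s n : 0 <= r -> 0 <= s ->
  (forall t, 0 < t -> n <= (1 + t) * r ^+ 2 + (1 + t^-1) * s ^+ 2) ->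
  n <= (r + s) ^+ 2.
Proof.
move=> r0 s0 h.
have bnd e : 0 < e -> n <= (r + s + 2 * e) ^+ 2.
  move=> e0; have re : 0 < r + e by lra.
  have se : 0 < s + e by lra.
  apply: le_trans (h ((s + e) / (r + e)) (divr_gt0 se re)) _.
  apply: (@le_trans _ _ ((1 + (s + e) / (r + e)) * (r + e) ^+ 2
      + (1 + ((s + e) / (r + e))^-1) * (s + e) ^+ 2)).
    rewrite lerD // ler_wpM2l ?ler_sqr ?nnegrE ?addr_ge0 ?invr_ge0 ?divr_ge0 //;
    lra.
  rewrite le_eqVlt; apply/orP; left; apply/eqP; field.
  by rewrite !gt_eqF.
apply/ler_addgt0Pr => e e0.
(* [(r + s + 2 d)^2] exceeds [(r + s)^2] by [4 d (r + s + d) <= 4 d w], which is at most [e] for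
   this [d]. *)
pose w := r + s + 1; pose d := Num.min 1 (e / (8 * w)).
have w1 : 1 <= w by rewrite /w; lra.
have w8 : 0 < 8 * w by lra.
have d0 : 0 < d by rewrite lt_min ltr01 divr_gt0.
have d1 : d <= 1 by rewrite ge_min lexx.
have de : d * (8 * w) <= e by rewrite -ler_pdivlMr // ge_min lexx orbT.
apply: le_trans (bnd d d0) _; rewrite /w in de; nra.
Qed.

(* Summing [inner_sqD_le] and optimising [t] replaces Cauchy-Schwarz in the
   module of square summable sequences. *)
Lemma is_sq_sum_triangle J f g (s t u : A) : is_sq_sum J f s -> is_sq_sum J g t ->
  is_sq_sum J (fun i => f i + g i) u ->
  Num.sqrt (cnorm u) <= Num.sqrt (cnorm s) + Num.sqrt (cnorm t).
Proof.
move=> hs ht hu.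
rewrite -ler_sqr ?nnegrE ?addr_ge0 ?sqrtr_ge0 // sqr_sqrtr ?cnorm_ge0 //.
apply: le_sqrD; rewrite ?sqrtr_ge0 // => r r0; rewrite !sqr_sqrtr ?cnorm_ge0 //.
have r1 : 0 < r^-1 by rewrite invr_gt0.
have le : npos (cst A (1 + r) * s + cst A (1 + r^-1) * t - u).
  apply: closed_npos (ccvgD (ccvgD (ccvgMl _ hs) (ccvgMl _ ht)) (ccvgN hu)) => n.
  rewrite /sq_psum !mulr_sumr -big_split -sumrB /=.
  apply: (big_ind (@npos R A)) => [|a b|i _].
  - by rewrite -cst0; exact: npos_cst.
  - exact: nposD.
  - exact: inner_sqD_le.
apply: le_trans (cnorm_le_npos (is_sq_sum_npos hu) le) _.
apply: le_trans (ler_cnormD _ _) _.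
by rewrite !cnorm_cstM !gtr0_norm //; lra.
Qed.
End HilbertModule.

(** * Confined weights and the perturbation estimate *)

(** The chain [0 < inf <= sup < +oo] forces both extended reals to be finite, so they serve as [m]
    and [M]. *)
Lemma positively_confined_bounds (R : realType) (J : set nat) (al : nat -> R) :
  positively_confined J al ->
  exists m M : R, [/\ 0 < m, 0 < M & forall i, i \in J -> m <= al i <= M].
Proof.
rewrite /positively_confined; set s := [set _ | _ in J] => -[].
have sJ i : i \in J -> s (al i)%:E by rewrite inE => Ji; exists i.
have lb i : i \in J -> (ereal_inf s <= (al i)%:E)%E.
  by move=> /sJ; exact: ereal_inf_lbound.
have ub i : i \in J -> ((al i)%:E <= ereal_sup s)%E.
  by move=> /sJ; exact: ereal_sup_ubound.
move: (ereal_inf s) (ereal_sup s) lb ub => [m| |] [M| |] //= lb ub.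
rewrite lte_fin lee_fin => m0 mM _; exists m, M; split=> //.
  exact: lt_le_trans mM.
by move=> i iJ; rewrite -!lee_fin lb // ub.
Qed.

(** Eliminating [d] gives [(1 - mu) sqrt p <= (1 + lam) sqrt q]. The lemma is used twice, with the
    two families exchanged. *)
Lemma le_sqrt_ratio (R : realType) (p q d lam mu : R) : 0 <= p -> 0 <= q ->
  0 <= lam -> mu < 1 -> Num.sqrt p <= Num.sqrt q + Num.sqrt d ->
  Num.sqrt d <= lam * Num.sqrt q + mu * Num.sqrt p ->
  p <= ((1 + lam) / (1 - mu)) ^+ 2 * q.
Proof.
move=> p0 q0 l0 mu1 h1 h2; have m0 : 0 < 1 - mu by lra.
have h : Num.sqrt p <= (1 + lam) / (1 - mu) * Num.sqrt q.
  by rewrite mulrAC ler_pdivlMr //; lra.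
rewrite -[p]sqr_sqrtr // -[q in X in _ <= X]sqr_sqrtr // -exprMn.
by rewrite ler_sqr // nnegrE ?sqrtr_ge0 // (le_trans _ h) // sqrtr_ge0.
Qed.

Theorem theorem5p1 (R : realType) (A : cstarAlgType R) (H : hilbertModType A)
    (K : adjointable H) (J : set nat) (T S : nat -> adjointable H) (a b : R)
    (hT : koperator_frame_bounds K J T a b)
    (al be : nat -> R)
    (hal : positively_confined J al) (hbe : positively_confined J be)
    (lam mu : R) (hlam : 0 <= lam < 1) (hmu : 0 <= mu < 1)
    (hpert : forall x : H,
      let aT := fun i => scale_real (al i) (T i x) in
      let bS := fun i => scale_real (be i) (S i x) in
      let d := fun i => aT i - bS i in
      exists sd sT sS : A,
        [/\ is_sq_sum J d sd, is_sq_sum J aT sT, is_sq_sum J bS sS &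
            Num.sqrt (cnorm sd) <=
              lam * Num.sqrt (cnorm sT) + mu * Num.sqrt (cnorm sS)]) :
  koperator_frame K J S.
Proof.
have [a0 b0 hTx] := hT.
have [mA [MA [mA0 MA0 hA]]] := positively_confined_bounds hal.
have [mB [MB [mB0 MB0 hB]]] := positively_confined_bounds hbe.
have [/andP[lam0 lam1] /andP[mu0 mu1]] := (hlam, hmu).
(* [C] collects the chain from [|s|] through the weighted sums [sS] and [sT] and the frame sum [t]
   to [|<x, x>|]; [D] collects the chain from [|<K^* x, K^* x>|] through [t], [sT] and [sS] to
   [|s|]. *)
pose C := ((1 + lam) / (1 - mu) * MA / mB) ^+ 2 * b.
pose D := ((1 + mu) / (1 - lam) * MB / mA) ^+ 2 / a.
have C0 : 0 < C by rewrite mulr_gt0 // exprn_gt0 // !(mulr_gt0, invr_gt0); lra.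
have D0 : 0 < D.
  by rewrite mulr_gt0 ?invr_gt0 // exprn_gt0 // !(mulr_gt0, invr_gt0); lra.
have key x : exists s, [/\ is_sq_sum J (fun i => S i x) s,
    cnorm s <= C * cnorm (inner x x) &
    cnorm (inner (adj K x) (adj K x)) <= D * cnorm s].
  have [sd [sT [sS [hd hsT hsS hle]]]] := hpert x.
  have [t [ht /cstar_posE lKt /cstar_posE ltx]] := hTx x.
  rewrite !scale_cst in lKt ltx.
  have geB i : i \in J -> 1 <= (mB ^+ 2)^-1 * be i ^+ 2.
    move=> /hB/andP[mb _]; rewrite mulrC ler_pdivlMr ?exprn_gt0 // mul1r.
    by rewrite ler_sqr ?nnegrE //; lra.
  have geA i : i \in J -> 1 <= (mA ^+ 2)^-1 * al i ^+ 2.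
    move=> /hA/andP[ma _]; rewrite mulrC ler_pdivlMr ?exprn_gt0 // mul1r.
    by rewrite ler_sqr ?nnegrE //; lra.
  have leB i : i \in J -> be i ^+ 2 <= MB ^+ 2.
    by move=> /hB/andP[? ?]; rewrite ler_sqr ?nnegrE //; lra.
  have leA i : i \in J -> al i ^+ 2 <= MA ^+ 2.
    by move=> /hA/andP[? ?]; rewrite ler_sqr ?nnegrE //; lra.
  have [iA0 iB0] : 0 <= (mA ^+ 2)^-1 /\ 0 <= (mB ^+ 2)^-1.
    by rewrite !invr_ge0 !sqr_ge0.
  (* The weights [be i >= mB] let the unweighted series inherit convergence from the weighted
     one. *)
  have [s hs] := is_sq_sum_comparison iB0
    (fun i iJ => inner_scale_real_ge (S i x) (geB i iJ)) hsS.
  exists s.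
  have lS1 := cnorm_le_nposZ iB0 (is_sq_sum_npos hs) (is_sq_sum_le
    (fun i iJ => inner_scale_real_ge (S i x) (geB i iJ)) hs hsS).
  have lS2 := cnorm_le_nposZ (sqr_ge0 MB) (is_sq_sum_npos hsS) (is_sq_sum_le
    (fun i iJ => inner_scale_real_le (S i x) (leB i iJ)) hsS hs).
  have lT1 := cnorm_le_nposZ iA0 (is_sq_sum_npos ht) (is_sq_sum_le
    (fun i iJ => inner_scale_real_ge (T i x) (geA i iJ)) ht hsT).
  have lT2 := cnorm_le_nposZ (sqr_ge0 MA) (is_sq_sum_npos hsT) (is_sq_sum_le
    (fun i iJ => inner_scale_real_le (T i x) (leA i iJ)) hsT ht).
  have tx := cnorm_le_nposZ (ltW b0) (is_sq_sum_npos ht) ltx.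
  have Kt := cnorm_le_npos (nposZ (ltW a0) (npos_inner _)) lKt.
  rewrite cnorm_cstM gtr0_norm // mulrC -ler_pdivlMr // in Kt.
  (* Triangle inequality for [bS = aT + (- d)]. *)
  have ST : cnorm sS <= ((1 + lam) / (1 - mu)) ^+ 2 * cnorm sT.
    apply: le_sqrt_ratio hle; rewrite ?cnorm_ge0 //.
    apply: is_sq_sum_triangle hsT (is_sq_sumN hd) _.
    by under eq_fun do rewrite subKr.
  (* Triangle inequality for [aT = bS + d], with [lam] and [mu] exchanged in the hypothesis. *)
  have TS : cnorm sT <= ((1 + mu) / (1 - lam)) ^+ 2 * cnorm sS.
    rewrite addrC in hle; apply: le_sqrt_ratio hle; rewrite ?cnorm_ge0 //.
    apply: is_sq_sum_triangle hsS hd _.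
    by under eq_fun do rewrite subrKC.
  split=> //.
    have -> : C * cnorm (inner x x) = (mB ^+ 2)^-1 *
        (((1 + lam) / (1 - mu)) ^+ 2 * (MA ^+ 2 * (b * cnorm (inner x x)))).
      by rewrite /C; field; rewrite !gt_eqF //; lra.
    apply: le_trans lS1 _; apply: ler_wpM2l => //.
    apply: le_trans ST _; apply: ler_wpM2l; first exact: sqr_ge0.
    by apply: le_trans lT2 _; apply: ler_wpM2l => //; exact: sqr_ge0.
  have -> : D * cnorm s = ((mA ^+ 2)^-1 *
      (((1 + mu) / (1 - lam)) ^+ 2 * (MB ^+ 2 * cnorm s))) / a.
    by rewrite /D; field; rewrite !gt_eqF //; lra.
  apply: le_trans Kt _; rewrite ler_pM2r ?invr_gt0 //.
  apply: le_trans lT1 _; apply: ler_wpM2l => //.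
  apply: le_trans TS _; apply: ler_wpM2l => //; exact: sqr_ge0.
(* By uniqueness of sums, [key] at [h x] becomes the norm inequality between conjugates by [h] that
   [npos_of_conj_cnorm] requires. *)
have sum_scale x s h : star h = h -> is_sq_sum J (fun i => S i x) s ->
    is_sq_sum J (fun i => S i (h *: x)) (h * s * h).
  move=> sh hs; have := is_sq_sumZ h hs; rewrite sh.
  by under [fun i => h *: _]eq_fun do rewrite -opZ.
exists D^-1, C; split=> [||x]; rewrite ?invr_gt0 //.
have [s [hs _ _]] := key x; exists s; split=> //.
  apply/cstar_posE; rewrite scale_cst.
  have -> : s - cst A D^-1 * inner (adj K x) (adj K x)
      = cst A D^-1 * (cst A D * s - inner (adj K x) (adj K x)).
    by rewrite mulrBr mulrA -cstM mulVf ?gt_eqF // cst1 mul1r.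
  apply: nposZ; first by rewrite invr_ge0 ltW.
  apply: npos_of_conj_cnorm; [exact: (npos_inner _).1|exact: is_sq_sum_npos hs|
    exact: ltW|].
  move=> h sh; have [s' [hs' _]] := key (h *: x).
  rewrite adjZ inner_sqZ sh.
  by rewrite (ccvg_unique hs' (sum_scale _ _ _ sh hs)).
apply/cstar_posE; rewrite scale_cst.
apply: npos_of_conj_cnorm; [exact: (is_sq_sum_npos hs).1|exact: npos_inner|
  exact: ltW|].
move=> h sh; have [s' [hs' + _]] := key (h *: x).
by rewrite inner_sqZ sh (ccvg_unique hs' (sum_scale _ _ _ sh hs)).
Qed.
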